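(* For $n\geq1$, \[u_{2n}=2\sum_{2i+j=2n-1}u_{2i}u_j+\sum_{2i+1+j=2n-2}u_{2i+1}u_j-u_{2n-1},\] where sums are over integers $i,j\ge0$, and, with $U_e(x)=\sum_{n\geq0}u_{2n}x^{2n}$ and $U_o(x)=\sum_{n\geq0}u_{2n+1}x^{2n+1}$, \[U_e(x)=1+2xU_e(x)U_o(x)-x^2U_e^2(x).\]
   Context: For a multiset $M$ of positive integers, a permutation of $M$ is a word using each element of $M$ with its multiplicity. A word $w_1\cdots w_m$ contains the pattern $132$ if there are $a<b<c$ with $w_a<w_c<w_b$; otherwise it is $132$-avoiding. For $n\ge0$ let $u_{2n}$ be the number of $132$-avoiding permutations of $\{1^2,\dots,n^2\}$ (each of $1,\dots,n$ twice) and $u_{2n+1}$ the number of $132$-avoiding permutations of $\{1^2,\dots,n^2,n+1\}$; $u_0=1$ and $u_m=0$ for $m<0$. *)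

(* Defs.v *)
From mathcomp Require Import all_boot all_order all_algebra.

Set Implicit Arguments.
Unset Strict Implicit.
Unset Printing Implicit Defensive.

Import Order.TTheory GRing.Theory Num.Theory.

Definition contains132 (w : seq nat) : bool :=
  [exists a : 'I_(size w), exists b : 'I_(size w), exists c : 'I_(size w),
    [&& a < b, b < c, nth 0 w a < nth 0 w c & nth 0 w c < nth 0 w b]].

Definition avoids132 (w : seq nat) : bool := ~~ contains132 w.

(* {1^2, ..., n^2} if m = 2n, and {1^2, ..., n^2, n+1} if m = 2n+1. *)
Definition letters (m : nat) : seq nat :=
  flatten [seq nseq 2 i | i <- iota 1 m./2] ++ nseq (odd m) m./2.+1.

(* permutations s lists each rearrangement of s exactly once, also when s has
   repeated entries. *)
Definition u (m : nat) : nat := count avoids132 (permutations (letters m)).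

Local Open Scope ring_scope.

(* Formal power series, given by their coefficients; to be compared with =1. *)
Definition fps (R : pzRingType) : Type := nat -> R.

Section FPS.
Variable R : pzRingType.
Implicit Types f g : fps R.

Definition fpsC (c : R) : fps R := fun k => if k == 0%N then c else 0.
Definition fpsX : fps R := fun k => if k == 1%N then 1 else 0.
Definition fps_add f g : fps R := fun k => f k + g k.
Definition fps_sub f g : fps R := fun k => f k - g k.
Definition fps_mul f g : fps R := fun k => \sum_(i < k.+1) f i * g (k - i)%N.
Definition fps_exp f (n : nat) : fps R := iter n (fps_mul f) (fpsC 1).

End FPS.

Arguments fpsX {R}.

Declare Scope fps_scope.
Delimit Scope fps_scope with fps.
Bind Scope fps_scope with fps.
Notation "c %:S" := (fpsC c) (at level 2, left associativity, format "c %:S") : fps_scope.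
Notation "'x" := fpsX (at level 0) : fps_scope.
Infix "+" := fps_add : fps_scope.
Infix "-" := fps_sub : fps_scope.
Infix "*" := fps_mul : fps_scope.
Infix "^+" := fps_exp : fps_scope.

Definition Ue : fps int := fun m => if odd m then 0 else (u m)%:Z.
Definition Uo : fps int := fun m => if odd m then (u m)%:Z else 0.

(* Main.v *)
Require Import Defs.
From mathcomp Require Import all_boot all_order all_algebra.
From Stdlib Require Import Setoid Morphisms Ring.
From mathcomp Require Import zify.

(** Cut a 132-avoiding word at the first occurrence of its largest letter M as
    v M w. It avoids 132 iff v and w do and every letter of w other than M is at
    most every letter of v. So if s is sorted and below M, then the number of
    avoiders of s M^(r+1) is the sum over k of (avoiders of (take k s) M^r) times
    (avoiders of drop k s). Every multiset met when iterating this from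
    1 1 2 2 3 3 ... is a factor of that word, whose number of avoiders depends on
    its length and on the parity of its starting position only. Sorting factors
    by the parities of both ends gives four series E, O, P, H (even-even,
    even-odd, odd-even, odd-odd) with
      O = x (E^2 + O P),               H = 1 + x (P E + H P),
      E = 1 + x^2 ((E^2 + O P) E + (E O + O H) P),
      P = x + x^2 ((P E + H P) E + (P O + H^2) P),
    where E = U_e and O = U_o. Eliminating, P - O is divisible by all powers of
    x, so P = O; hence H = E + x O, and the two identities follow. *)

Import Order.TTheory GRing.Theory Num.Theory.

Set Implicit Arguments.
Unset Strict Implicit.
Unset Printing Implicit Defensive.

(** * Occurrences of 132 as subsequences, and cutting at a largest letter *)

Lemma contains132P (w : seq nat) :
  reflect (exists x y z, [/\ x < z, z < y & subseq [:: x; y; z] w])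
          (contains132 w).
Proof.
have wE : [seq nth 0 w i | i <- iota 0 (size w)] = w by apply: mkseq_nth.
apply: (iffP existsP) => [[a /existsP[b /existsP[c /and4P[ab bc ac cb]]]]|].
  exists (nth 0 w a), (nth 0 w b), (nth 0 w c); split=> //.
  rewrite -[X in subseq _ X]wE.
  rewrite -[X in subseq X _]/(map (nth 0 w) [:: val a; val b; val c]).
  (* It remains to compare two strictly increasing lists of positions, which are equal once they
     have the same elements. *)
  apply: map_subseq; apply/subseq_uniqP; first exact: iota_uniq.
  apply: (irr_sorted_eq ltn_trans ltnn) => [||i].
  - by rewrite /= ab bc.
  - exact: (sorted_filter ltn_trans _ (iota_ltn_sorted _ _)).
  rewrite mem_filter mem_iota /= add0n !inE andb_idr //.
  by case/or3P=> /eqP->; apply: ltn_ord.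
case=> x [y [z [xz zy /subseqP[m _ wm]]]].
move: wm; rewrite -[in mask _ _]wE -map_mask.
have: subseq (mask m (iota 0 (size w))) (iota 0 (size w)) by apply: mask_subseq.
case: (mask m _) => [|a [|b [|c []]]] // sub [xE yE zE].
have /= /and3P[ab bc _] := subseq_sorted ltn_trans sub (iota_ltn_sorted _ _).
have lt_w i : i \in [:: a; b; c] -> i < size w.
  by move/(mem_subseq sub); rewrite mem_iota.
have aw : a < size w by apply: lt_w; rewrite !inE eqxx.
have bw : b < size w by apply: lt_w; rewrite !inE eqxx orbT.
have cw : c < size w by apply: lt_w; rewrite !inE eqxx !orbT.
exists (Ordinal aw); apply/existsP; exists (Ordinal bw); apply/existsP.
by exists (Ordinal cw); rewrite /= ab bc -xE -yE -zE xz.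
Qed.

Lemma contains132_subseq (v w : seq nat) :
  subseq v w -> contains132 v -> contains132 w.
Proof.
move=> vw /contains132P[x [y [z [xz zy sub]]]]; apply/contains132P.
by exists x, y, z; split=> //; apply: subseq_trans vw.
Qed.

Lemma contains132_map (f : nat -> nat) (w : seq nat) :
  {mono f : i j / i < j} -> contains132 (map f w) = contains132 w.
Proof.
move=> fM; apply/contains132P/contains132P => [|[x [y [z [xz zy sub]]]]].
  case=> x [y [z [xz zy /subseqP[m _]]]]; rewrite -map_mask.
  have := mask_subseq m w.
  case: (mask m w) => [|a [|b [|c []]]] // sub [xE yE zE].
  by exists a, b, c; rewrite -(fM a c) -(fM c b) -xE -yE -zE.
by exists (f x), (f y), (f z); rewrite !fM; split=> //; apply: (map_subseq f sub).
Qed.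

(* If the end letters x < z of an occurrence were on both sides of M, then
   z < M, as z is not the largest letter of the occurrence. *)
Lemma avoids132_cat_max (M : nat) (v w : seq nat) :
  all (leq^~ M) (v ++ w) ->
  avoids132 (v ++ M :: w) =
    [&& avoids132 v, avoids132 w &
        allrel (fun a b => (M <= b) || (b <= a)) v w].
Proof.
rewrite all_cat => /andP[/allP vM /allP wM].
apply/idP/and3P => [av|[av aw /allrelP vw]].
  split.
  - by apply: contra av; apply/contains132_subseq/prefix_subseq.
  - apply: contra av; apply: contains132_subseq.
    by apply: (subseq_trans (subseq_cons w M)); apply: suffix_subseq.
  apply/allrelP=> a b a_v b_w; case: leqP => //= bM; rewrite leqNgt.
  apply: contra av => ab; apply/contains132P; exists a, M, b; split=> //.
  rewrite -[[:: a; M; b]]/([:: a] ++ [:: M; b]).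
  by apply: cat_subseq; rewrite /= ?eqxx sub1seq.
apply/contains132P=> -[x [y [z [xz zy /subseqP[m sz_m]]]]].
have Mw_le b : b \in M :: w -> b <= M by rewrite inE => /predU1P[->|/wM].
have lt_wz b : b < M -> b \in M :: w -> b \in w.
  by move=> bM; rewrite inE => /predU1P[bE|//]; rewrite bE ltnn in bM.
rewrite -(cat_take_drop (size v) m) mask_cat; last first.
  by rewrite size_takel // sz_m size_cat leq_addr.
have := mask_subseq (take (size v) m) v.
have := mask_subseq (drop (size v) m) (M :: w).
(* The cases count how many of [x], [y], [z] are picked from [v]; the rest come from [M :: w]. *)
case: (mask _ v) => [|a [|b [|c [|]]]] //.
- move=> sub _ /= E; rewrite -{}E in sub.
  have yM : y <= M by apply: Mw_le; apply: (mem_subseq sub); rewrite !inE eqxx orbT.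
  move: sub; rewrite /=; case: ifP => [/eqP xM _|_ sub]; first by lia.
  by move/negP: aw; apply; apply/contains132P; exists x, y, z.
- move=> sub2 sub1 [xE E]; rewrite -{}E in sub2.
  have yM : y <= M by apply: Mw_le; apply: (mem_subseq sub2); rewrite !inE eqxx.
  have z_w : z \in w.
    by apply: lt_wz; [lia|apply: (mem_subseq sub2); rewrite !inE eqxx orbT].
  have := vw a z; rewrite -sub1seq sub1 z_w => /(_ isT isT); lia.
- move=> sub2 sub1 [xE yE E]; rewrite -{}E in sub2.
  have yM : y <= M by apply: vM; apply: (mem_subseq sub1); rewrite !inE -yE eqxx orbT.
  have z_w : z \in w.
    by apply: lt_wz; [lia|apply: (mem_subseq sub2); rewrite inE].
  have a_v : a \in v by apply: (mem_subseq sub1); rewrite inE eqxx.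
  by have := vw a z a_v z_w; lia.
- move=> _ sub [xE yE zE]; case: (mask _ _) => // _; move/negP: av; apply.
  by apply/contains132P; exists x, y, z; split=> //; rewrite xE yE zE.
Qed.

(** * Avoiders of a multiset and the recurrence from the first largest letter *)

Lemma perm_cat_cons (T : eqType) (a : T) (v w s t : seq T) :
  perm_eq (v ++ a :: w) (s ++ a :: t) = perm_eq (v ++ w) (s ++ t).
Proof.
rewrite -[a :: w]cat1s -[a :: t]cat1s perm_catCA perm_sym perm_catCA.
by rewrite perm_cat2l perm_sym.
Qed.

Definition avoiders (s : seq nat) : seq (seq nat) :=
  filter avoids132 (permutations s).

Lemma mem_avoiders s w : (w \in avoiders s) = avoids132 w && perm_eq w s.
Proof. by rewrite mem_filter mem_permutations. Qed.

Lemma avoiders_uniq s : uniq (avoiders s).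
Proof. by rewrite filter_uniq ?permutations_uniq. Qed.

Lemma size_avoiders_map (f : nat -> nat) (s : seq nat) :
  {mono f : i j / i < j} -> size (avoiders (map f s)) = size (avoiders s).
Proof.
move=> fM; have f_inj : injective f.
  by move=> i j ij; have := fM i j; have := fM j i; rewrite ij ltnn; lia.
rewrite -(size_map (map f) (avoiders s)); apply/perm_size/uniq_perm.
- exact: avoiders_uniq.
- by rewrite (map_inj_uniq (inj_map f_inj)) avoiders_uniq.
move=> w; rewrite mem_avoiders; apply/andP/mapP => [[aw]|[v]].
  (* Reading [s] instead of [map f s] along the same list of positions [I] gives the preimage of
     [w]. *)
  case/(perm_iotaP 0) => I; rewrite size_map => pI wE.
  have {}wE : w = map f [seq nth 0 s i | i <- I].
    rewrite wE -map_comp; apply/eq_in_map => i /=; rewrite (perm_mem pI).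
    by rewrite mem_iota => /= lt_i; rewrite (nth_map 0).
  exists [seq nth 0 s i | i <- I] => //.
  move: aw; rewrite wE mem_avoiders /avoids132 contains132_map // => ->.
  by apply/(perm_iotaP 0); exists I.
rewrite mem_avoiders => /andP[av pv] ->.
by rewrite /avoids132 contains132_map // perm_map.
Qed.

(** The letters of [w] other than [M] are at most those of [v], so sorting the former, then the
    latter, yields a sorted rearrangement of [s], that is, [s] itself. Hence [k] is the number of
    letters of [w] other than [M]. *)
Lemma perm_cat_max_cut (M r : nat) (s v w : seq nat) :
  sorted leq s -> all (ltn^~ M) s -> M \notin v ->
  allrel (fun a b => (M <= b) || (b <= a)) v w ->
  perm_eq (v ++ w) (s ++ nseq r M) ->
  exists2 k, k <= size s &
    perm_eq v (drop k s) /\ perm_eq w (take k s ++ nseq r M).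
Proof.
move=> s_sorted /allP sM Mv /allrelP vw vws.
pose w' := [seq b <- w | b != M].
have notMs : all (predC1 M) s by apply/allP => i /sM /=; lia.
have notMv : all (predC1 M) v.
  by apply/allP => i /= iv; apply: contraNneq Mv => <-.
have pw's : perm_eq (v ++ w') s.
  have := perm_filter (predC1 M) vws; rewrite !filter_cat.
  rewrite (all_filterP notMs) (all_filterP notMv).
  by rewrite [filter _ (nseq _ _)]filter_nseq /= eqxx cats0.
have ltw' b : b \in w' -> b < M.
  by move=> bw'; apply: sM; rewrite -(perm_mem pw's) mem_cat bw' orbT.
have sE : s = sort leq w' ++ sort leq v.
  apply: (sorted_eq leq_trans anti_leq) => //.
    rewrite (sorted_pairwise leq_trans) pairwise_cat -!(sorted_pairwise leq_trans).
    rewrite !(sort_sorted leq_total) !andbT; apply/allrelP=> b a.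
    rewrite !mem_sort => bw' av; have /ltw' := bw'.
    by move: bw'; rewrite mem_filter => /andP[_ bw]; have := vw a b av bw; lia.
  rewrite perm_sym -(permPr pw's) perm_catC; apply: perm_cat;
  by rewrite perm_sort.
have pw : perm_eq w (w' ++ nseq r M).
  have pw1 : perm_eq w (w' ++ nseq (count_mem M w) M).
    rewrite -(perm_filterC (predC1 M) w) perm_cat2l.
    have -> : filter (predC (predC1 M)) w = filter (pred1 M) w.
      by apply: eq_filter => i /=; rewrite negbK.
    by have /all_pred1P := filter_all (pred1 M) w; rewrite size_filter => ->.
  suff <- : count_mem M w = r by [].
  have /permP/(_ (pred1 M)) := vws; rewrite !count_cat count_nseq /= eqxx mul1n.
  have -> : count_mem M v = 0 by apply/count_memPn.
  have -> // : count_mem M s = 0.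
  by apply/count_memPn; apply/negP => /sM; rewrite /= ltnn.
exists (size w'); first by rewrite sE size_cat size_sort leq_addr.
rewrite sE drop_size_cat ?take_size_cat ?size_sort //.
rewrite perm_sym perm_sort; split=> //.
by rewrite (permPl pw) perm_cat2r perm_sym perm_sort.
Qed.

(** Gluing [v] and [w] around an [M] is a bijection from the pairs in [parts k], over all [k], to
    the avoiders; its inverse cuts at the first [M]. *)
Lemma size_avoiders_cut (M r : nat) (s : seq nat) :
  sorted leq s -> all (ltn^~ M) s ->
  size (avoiders (s ++ nseq r.+1 M)) =
    \sum_(k < (size s).+1)
      size (avoiders (take k s ++ nseq r M)) * size (avoiders (drop k s)).
Proof.
move=> s_sorted /[dup] s_ltM /allP sM.
pose parts k := [seq (v, w) | v <- avoiders (drop k s),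
                              w <- avoiders (take k s ++ nseq r M)].
pose glue (k : nat) (p : seq nat * seq nat) := p.1 ++ M :: p.2.
have partsP k p : p \in parts k ->
  [/\ p.1 \in avoiders (drop k s), p.2 \in avoiders (take k s ++ nseq r M)
    & M \notin p.1].
  case/allpairsP=> -[v w] [/= vP wP ->]; split=> //=.
  move: vP; rewrite mem_avoiders => /andP[_ pv]; rewrite (perm_mem pv).
  by apply/negP => /mem_drop /sM; rewrite /= ltnn.
have vxM v x : perm_eq (v ++ x) (s ++ nseq r M) -> all (leq^~ M) (v ++ x).
  move=> pvx; rewrite (perm_all _ pvx) all_cat; apply/andP; split.
    by apply/allP=> i /sM /ltnW.
  by apply/allP=> i; rewrite mem_nseq => /andP[_ /eqP->].
transitivity (size [seq glue k p | k <- iota 0 (size s).+1, p <- parts k]).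
  apply/perm_size/uniq_perm; first exact: avoiders_uniq.
    apply: allpairs_uniq_dep => [|k _|]; first exact: iota_uniq.
      by apply: allpairs_uniq; rewrite ?avoiders_uniq // => -[? ?] [? ?] _ _ [-> ->].
    move=> _ _ /allpairsPdep[k [p [kI pP ->]]] /allpairsPdep[l [q [lI qP ->]]].
    rewrite /= /glue; case: p pP => v w /partsP /= [vP _ Mv].
    case: q qP => v' w' /partsP /= [vP' _ Mv'] E.
    (* Neither [v] nor [v'] contains [M], so both lengths are the index of the first [M] in the
       glued word. The length of [v] in turn determines [k]. *)
    have szE : size v = size v'.
      move/(congr1 (index M)): E; rewrite !index_cat (negbTE Mv) (negbTE Mv').
      by rewrite /= eqxx !addn0.
    move/eqP: E; rewrite eqseq_cat // eqseq_cons eqxx /= => /andP[/eqP<- /eqP<-].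
    suff -> : k = l by [].
    move: vP vP' szE kI lI; rewrite !mem_avoiders !mem_iota.
    case/andP=> _ /perm_size-> /andP[_ /perm_size->].
    by rewrite !size_drop !add0n /= !ltnS => E ks ls; rewrite -(subKn ks) E subKn.
  move=> w; apply/idP/allpairsPdep => [|[k [p [_ /partsP[pP qP Mp] ->]]]].
    rewrite mem_avoiders => /andP[aw pw].
    have Mw : M \in w by rewrite (perm_mem pw) mem_cat mem_nseq eqxx orbT.
    have Mtake : M \notin take (index M w) w by rewrite in_take ?ltnn // index_size.
    have wE : w = take (index M w) w ++ M :: drop (index M w).+1 w.
      by rewrite -{1}(cat_take_drop (index M w) w) (drop_nth M) ?index_mem ?nth_index.
    rewrite {}wE in aw pw *; move: aw pw Mtake.
    move: (take _ _) (drop _ _) => v x avx pvx Mv.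
    rewrite perm_cat_cons in pvx.
    move: avx; rewrite avoids132_cat_max ?vxM // => /and3P[av ax vx].
    have [k ks [pv px]] := perm_cat_max_cut s_sorted s_ltM Mv vx pvx.
    exists k, (v, x); split=> //; first by rewrite mem_iota.
    by apply: allpairs_f; rewrite mem_avoiders ?av ?ax.
  case: p pP qP Mp => v x /=; rewrite !mem_avoiders /glue /=.
  move=> /andP[av pv] /andP[ax px] Mv.
  have pvx : perm_eq (v ++ x) (s ++ nseq r M).
    apply: (perm_trans (perm_cat pv px)).
    by rewrite catA perm_cat2r perm_catC cat_take_drop.
  rewrite avoids132_cat_max ?vxM // av ax /=; apply/andP; split.
    apply/allrelP => a b; rewrite (perm_mem pv) (perm_mem px) mem_cat => a_s.
    case/orP => [b_s|]; last by rewrite mem_nseq => /andP[_ /eqP->]; rewrite leqnn.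
    move: s_sorted; rewrite (sorted_pairwise leq_trans) -(cat_take_drop k s).
    rewrite pairwise_cat => /and3P[/allrelP le_s _ _].
    by rewrite (le_s b a) ?orbT.
  by rewrite perm_cat_cons.
rewrite size_allpairs_dep sumnE big_map -[iota 0 _]/(index_iota 0 (size s).+1).
rewrite big_mkord.
by apply: eq_bigr => k _; rewrite size_allpairs mulnC.
Qed.

(** * Counting avoiders of the factors of 1 1 2 2 3 3 .. *)

(* The factor of length l, starting at position a, of 1 1 2 2 3 3 ... *)
Definition segment (a l : nat) : seq nat := [seq p./2.+1 | p <- iota a l].

Definition nsegment (a l : nat) : nat := size (avoiders (segment a l)).

Lemma segmentD a l m : segment a (l + m) = segment a l ++ segment (a + l) m.
Proof. by rewrite /segment iotaD map_cat. Qed.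

Lemma letters_segment m : letters m = segment 0 m.
Proof.
have pairs n : flatten [seq nseq 2 i | i <- iota 1 n] = segment 0 n.*2.
  elim: n => [//|n IHn]; rewrite -[n.+1]addn1 iotaD.
  rewrite map_cat flatten_cat IHn doubleD segmentD /segment /=.
  by rewrite add0n add1n; congr (_ ++ [:: _; _]); lia.
rewrite /letters pairs -[in RHS](odd_double_half m) addnC segmentD /segment.
by case: (odd m); rewrite ?cats0 //= add0n doubleK.
Qed.

Lemma u_nsegment m : u m = nsegment 0 m.
Proof. by rewrite /u letters_segment -size_filter. Qed.

Lemma avoids132_short w : size w < 3 -> avoids132 w.
Proof.
move=> sz_w; apply/contains132P => -[x [y [z [_ _ /size_subseq]]]].
by rewrite leqNgt sz_w.
Qed.

Lemma nsegment0 a : nsegment a 0 = 1.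
Proof. by rewrite /nsegment /avoiders /= avoids132_short. Qed.

Lemma nsegment1 a : nsegment a 1 = 1.
Proof. by rewrite /nsegment /avoiders /= avoids132_short. Qed.

(** Moving the start by two positions adds one to every letter, which preserves the order of
    letters. *)
Lemma nsegment_odd a l : nsegment a l = nsegment (odd a) l.
Proof.
rewrite -{1}(odd_double_half a); elim: a./2 => [|n IHn]; first by rewrite addn0.
rewrite -{}IHn doubleS !addnS /nsegment.
rewrite -[RHS](size_avoiders_map _ (f := succn)) //.
by rewrite -[(_ + _).+2]add2n /segment iotaDl -!map_comp; congr (size (avoiders _)).
Qed.

Lemma size_avoiders_segment_cut (M r a l : nat) :
  (forall p, p < a + l -> p./2.+1 < M) ->
  size (avoiders (segment a l ++ nseq r.+1 M)) =
    \sum_(k < l.+1)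
      size (avoiders (segment a k ++ nseq r M)) * nsegment (a + k) (l - k).
Proof.
move=> ltM; rewrite size_avoiders_cut.
- rewrite size_map size_iota; apply: eq_bigr => k _.
  rewrite /nsegment /segment -map_take -map_drop take_iota drop_iota.
  by have /minn_idPl-> : k <= l by rewrite -ltnS.
- apply: (homo_sorted (e := leq)) => [p q pq|]; first by rewrite ltnS half_leq.
  exact: iota_sorted.
by rewrite all_map; apply/allP => p; rewrite mem_iota => /andP[_ /ltM].
Qed.

(** The last letter sits at the even position [a + l], so it is the first copy of its value and the
    only largest letter. *)
Lemma nsegmentS a l : ~~ odd (a + l) ->
  nsegment a l.+1 = \sum_(k < l.+1) nsegment a k * nsegment (a + k) (l - k).
Proof.
move=> even_al; rewrite {1}/nsegment -[in LHS]addn1 segmentD.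
have -> : segment (a + l) 1 = nseq 1 (a + l)./2.+1 by [].
rewrite size_avoiders_segment_cut.
  by apply: eq_bigr => k _; rewrite cats0.
by move=> p; lia.
Qed.

(** Here the factor ends with both copies of its largest letter. The outer sum cuts at the first
    copy in the word, the inner one at the remaining copy. *)
Lemma nsegmentSS a l : ~~ odd (a + l) ->
  nsegment a l.+2 =
    \sum_(k < l.+1) (\sum_(j < k.+1) nsegment a j * nsegment (a + j) (k - j)) *
                    nsegment (a + k) (l - k).
Proof.
move=> even_al; rewrite {1}/nsegment -[in LHS]addn2 segmentD.
have -> : segment (a + l) 2 = nseq 2 (a + l)./2.+1.
  by rewrite /segment /=; congr [:: _; _]; lia.
rewrite size_avoiders_segment_cut => [|p]; last by lia.
apply: eq_bigr => k _; rewrite size_avoiders_segment_cut => [|p]; last first.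
  by have := ltn_ord k; lia.
by congr (_ * _); apply: eq_bigr => j _; rewrite cats0.
Qed.

(** * The ring of formal power series *)

Local Open Scope ring_scope.
Section FpsSetoid.
Variable R : pzRingType.
Implicit Types f g h : fps R.

(* The tactic ring needs a relation that is syntactically on fps R. *)
Definition fps_eq (f g : fps R) : Prop := f =1 g.

#[global] Instance fps_eq_equivalence : Equivalence fps_eq.
Proof. by split=> [f k|f g fg k|f g h fg gh k] //; rewrite ?fg ?gh. Qed.

#[global] Instance fps_add_proper :
  Proper (fps_eq ==> fps_eq ==> fps_eq) (@fps_add R).
Proof. by move=> f f' ff' g g' gg' k; rewrite /fps_add ff' gg'. Qed.

#[global] Instance fps_sub_proper :
  Proper (fps_eq ==> fps_eq ==> fps_eq) (@fps_sub R).
Proof. by move=> f f' ff' g g' gg' k; rewrite /fps_sub ff' gg'. Qed.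

#[global] Instance fps_mul_proper :
  Proper (fps_eq ==> fps_eq ==> fps_eq) (@fps_mul R).
Proof.
by move=> f f' ff' g g' gg' k; apply: eq_bigr => i _; rewrite ff' gg'.
Qed.

Definition fps_opp f : fps R := fun k => - f k.

Lemma fpsCM c f k : (c%:S * f)%fps k = c * f k.
Proof.
rewrite /fps_mul big_ord_recl subn0 big1 ?addr0 // => i _.
by rewrite /fpsC mul0r.
Qed.

Lemma fpsXM0 f : ('x * f)%fps 0%N = 0.
Proof. by rewrite /fps_mul big_ord1 mul0r. Qed.

Lemma fpsXMS f k : ('x * f)%fps k.+1 = f k.
Proof.
rewrite /fps_mul !big_ord_recl big1 ?addr0 => [|i _].
  by rewrite /fpsX /= mul0r mul1r add0r subSS subn0.
by rewrite /fpsX mul0r.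
Qed.

Lemma fps_mulDl f g h : ((f + g) * h =1 f * h + g * h)%fps.
Proof.
by move=> k; rewrite /fps_add -big_split; apply: eq_bigr => i _; apply: mulrDl.
Qed.

End FpsSetoid.

Infix "=f" := fps_eq (at level 70, no associativity) : fps_scope.

Section FpsCommutative.
Variable R : comNzRingType.
Implicit Types f g h : fps R.

(** Product coefficients of index below [n] agree with those of the truncated polynomials, so
    commutativity and associativity carry over from polynomials. *)
Let trunc n f : {poly R} := \poly_(i < n) f i.

Let fps_mulE n f g k : (k < n)%N ->
  (f * g)%fps k = (trunc n f * trunc n g)`_k.
Proof.
move=> kn; rewrite coefM; apply: eq_bigr => i _.
by have := ltn_ord i => ik; rewrite !coef_poly !ifT //; lia.
Qed.

Lemma fps_mulC f g : (f * g =1 g * f)%fps.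
Proof. by move=> k; rewrite !(fps_mulE _ _ (ltnSn k)) mulrC. Qed.

Lemma fps_mulA f g h : (f * (g * h) =1 f * g * h)%fps.
Proof.
move=> k; transitivity (trunc k.+1 f * (trunc k.+1 g * trunc k.+1 h))`_k.
  rewrite coefM; apply: eq_bigr => i _; rewrite coef_poly ltn_ord.
  by rewrite (@fps_mulE k.+1) // ltnS leq_subr.
rewrite mulrA coefM; apply: eq_bigr => i _; rewrite coef_poly ltnS leq_subr.
by rewrite (@fps_mulE k.+1).
Qed.

Lemma fps_expr2 f : (f ^+ 2 =f f * f)%fps.
Proof.
apply: fps_mul_proper => // k.
by rewrite /fps_exp /= fps_mulC fpsCM mul1r.
Qed.

End FpsCommutative.

Lemma fps_int_ring_theory :
  @ring_theory (fps int) (fpsC 0) (fpsC 1) (@fps_add int) (@fps_mul int)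
    (@fps_sub int) (@fps_opp int) (@fps_eq int).
Proof.
split.
- by move=> f k; rewrite /fps_add /fpsC if_same add0r.
- by move=> f g k; rewrite /fps_add addrC.
- by move=> f g h k; rewrite /fps_add addrA.
- by move=> f k; rewrite fpsCM mul1r.
- exact: fps_mulC.
- exact: fps_mulA.
- exact: fps_mulDl.
- by move=> f g k.
- by move=> f k; rewrite /fps_add /fps_opp /fpsC if_same subrr.
Qed.

Lemma fps_int_ring_eq_ext :
  ring_eq_ext (@fps_add int) (@fps_mul int) (@fps_opp int) (@fps_eq int).
Proof.
split; [exact: fps_add_proper|exact: fps_mul_proper|].
by move=> f f' ff' k; rewrite /fps_opp ff'.
Qed.

Definition fps_int_equivalence : Equivalence (@fps_eq int) :=
  fps_eq_equivalence int.

Add Ring fps_int : fps_int_ring_theory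
  (setoid fps_int_equivalence fps_int_ring_eq_ext).

(** Coefficients 0 and 1 of the right side vanish, and its coefficient [k.+2] involves those of [f]
    only up to [k]: strong induction applies. *)
Lemma fps_XX_fixed_eq0 (R : pzRingType) (f g : fps R) :
  (f =f 'x * ('x * (f * g)))%fps -> (f =f 0%:S)%fps.
Proof.
move=> fE k; rewrite /fpsC if_same; elim/ltn_ind: k => -[|[|k]] IH.
- by rewrite fE fpsXM0.
- by rewrite fE fpsXMS fpsXM0.
rewrite fE !fpsXMS; apply: big1 => i _; rewrite IH ?mul0r //.
by rewrite ltnS ltnW // ltnS -ltnS.
Qed.

(** * Elimination in the system of four series *)

Section System.
Local Open Scope fps_scope.
Variables E O P H : fps int.
Hypothesis E_eq :
  E =f 1%:S + 'x * ('x * ((E * E + O * P) * E + (E * O + O * H) * P)).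
Hypothesis O_eq : O =f 'x * (E * E + O * P).
Hypothesis P_eq :
  P =f 'x + 'x * ('x * ((P * E + H * P) * E + (P * O + H * H) * P)).
Hypothesis H_eq : H =f 1%:S + 'x * (P * E + H * P).

(* Equalities of power series below are checked as explicit linear combinations
   of these four residuals. *)
Let residual_E :=
  E - (1%:S + 'x * ('x * ((E * E + O * P) * E + (E * O + O * H) * P))).
Let residual_O := O - 'x * (E * E + O * P).
Let residual_P :=
  P - ('x + 'x * ('x * ((P * E + H * P) * E + (P * O + H * H) * P))).
Let residual_H := H - (1%:S + 'x * (P * E + H * P)).

Let fps_sub_eq0 (f g : fps int) : f =f g -> f - g =f 0%:S.
Proof. by move=> ->; ring. Qed.

Let residual_E0 : residual_E =f 0%:S. Proof. exact: fps_sub_eq0. Qed.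
Let residual_O0 : residual_O =f 0%:S. Proof. exact: fps_sub_eq0. Qed.
Let residual_P0 : residual_P =f 0%:S. Proof. exact: fps_sub_eq0. Qed.
Let residual_H0 : residual_H =f 0%:S. Proof. exact: fps_sub_eq0. Qed.

(* D = P - O and S = E + H satisfy D = x^2 D (S^2 - S), which forces D = 0. *)
Lemma system_P_eq_O : P =f O.
Proof.
have D0 : P - O =f 0%:S.
  apply: (@fps_XX_fixed_eq0 _ _ ((E + H) * (E + H) - (E + H))).
  (* The residuals outside the last product sum to P - O - x(E + H)(H - E - xP). The parenthesis
     multiplied by x(E + H) expands to H - E - xO - x(P - O)(E + H), and serves to eliminate H -
     E. *)
  transitivity ('x * ('x * ((P - O) * ((E + H) * (E + H) - (E + H))))
    + (residual_P - residual_O - 'x * H * residual_H - 'x * P * residual_O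
       - 'x * residual_H
       + 'x * (E + H) * (residual_H - residual_E + 'x * E * residual_O
                         + 'x * O * residual_H))).
    by rewrite /residual_E /residual_O /residual_P /residual_H; ring.
  by rewrite residual_E0 residual_O0 residual_P0 residual_H0; ring.
by transitivity (P - O + O); [ring|rewrite D0; ring].
Qed.

(** The first three residual terms give E = 1 + xO(E + H) - xO; the others substitute H = E + xO,
    which holds since P = O. *)
Lemma system_E_O :
  E =f 1%:S + (1%:S + 1%:S) * ('x * (E * O)) + 'x * ('x * (O * O)) - 'x * O.
Proof.
transitivity (1%:S + (1%:S + 1%:S) * ('x * (E * O)) + 'x * ('x * (O * O)) - 'x * O
  + (residual_E - 'x * E * residual_O - 'x * O * residual_H
     + 'x * O * (residual_H - residual_E + 'x * E * residual_O
                 + 'x * O * residual_H + 'x * (P - O) * (E + H)))).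
  by rewrite /residual_E /residual_O /residual_H; ring.
by rewrite residual_E0 residual_O0 residual_H0 system_P_eq_O; ring.
Qed.

Lemma system_O : O =f 'x * (E * E + O * O).
Proof. by rewrite {1}O_eq system_P_eq_O. Qed.

End System.

(** * Convolutions sorted by the parity of the cut position *)

Section ParitySplit.
Implicit Types (g h : bool -> nat -> int) (a b : bool).

(* When g a is indexed by a starting position mod 2, this keeps the factors that
   start at parity a and end before a position of parity b. *)
Definition split_parity g a b : fps int :=
  fun l => if odd l == a (+) b then g a l else 0.

Definition convolution g h a (l : nat) : int :=
  \sum_(k < l.+1) g a k * h (a (+) odd k) (l - k)%N.

(** This is a product of 2 by 2 matrices indexed by parities: each [k] contributes only to the
    product whose middle parity is that of the cut position, [a (+) odd k]. *)
Lemma split_parity_convolution g h a b :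
  fps_eq (split_parity (convolution g h) a b)
    (split_parity g a false * split_parity h false b +
     split_parity g a true * split_parity h true b)%fps.
Proof.
move=> l; rewrite /fps_add /fps_mul -big_split /split_parity.
case: ifP => lab; last first.
  rewrite big1 // => k _; have := ltn_ord k; rewrite ltnS => kl.
  move: lab; rewrite oddB //.
  by case: (odd l) (odd k) a b => [] [] [] []; rewrite //= ?mulr0 ?mul0r ?addr0.
apply: eq_bigr => k _; have := ltn_ord k; rewrite ltnS => kl.
move: lab; rewrite oddB //.
by case: (odd l) (odd k) a b => [] [] [] [];
   rewrite //= ?mulr0 ?mul0r ?addr0 ?add0r.
Qed.

End ParitySplit.

(** * The series of the factors and their functional equations *)

Definition nsegmentz (a : bool) (l : nat) : int := (nsegment a l)%:Z.

Lemma nsegmentz_xor (a : bool) k l :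
  nsegmentz (a (+) odd k) l = (nsegment (a + k) l)%:Z.
Proof. by rewrite /nsegmentz [in RHS]nsegment_odd oddD oddb. Qed.

(** With [false] for even, E, O, P, H are the values at [false false], [false true], [true false],
    [true true]. *)
Definition Useg (a b : bool) : fps int := split_parity nsegmentz a b.

Lemma convolution_nsegmentz (a : bool) l :
  convolution nsegmentz nsegmentz a l =
    (\sum_(k < l.+1) nsegment a k * nsegment (a + k) (l - k))%N%:Z.
Proof.
rewrite (big_morph Posz PoszD (erefl _)); apply: eq_bigr => k _.
by rewrite nsegmentz_xor PoszM.
Qed.

(** A nonempty factor ending before an odd position has a single largest letter, so [nsegmentS]
    applies. The constant term is the empty factor, present when the start is odd. *)
Lemma Useg_true a :
  (Useg a true =f (if a then 1%:S else 0%:S) +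
     'x * (Useg a false * Useg false false + Useg a true * Useg true false))%fps.
Proof.
rewrite -split_parity_convolution => -[|l]; rewrite /fps_add.
  by rewrite fpsXM0 /Useg /split_parity /nsegmentz nsegment0; case: a.
rewrite fpsXMS.
have -> : (if a then 1%:S else 0%:S)%fps l.+1 = 0 :> int by case: a.
rewrite add0r /Useg /split_parity /= addbF addbT.
have -> : (~~ odd l == ~~ a) = (odd l == a) by case: (odd l) a => [] [].
case: eqP => // al; rewrite convolution_nsegmentz /nsegmentz nsegmentS //.
by rewrite oddD oddb al addbb.
Qed.

(** From length two on, both copies of the largest letter are present and [nsegmentSS] applies. The
    initial term is the empty factor for an even start, and a lone second copy for an odd one. *)
Lemma Useg_false a :
  (Useg a false =f (if a then 'x else 1%:S) +
     'x * ('x * ((Useg a false * Useg false false + Useg a true * Useg true false) *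
                   Useg false false +
                 (Useg a false * Useg false true + Useg a true * Useg true true) *
                   Useg true false)))%fps.
Proof.
rewrite -!split_parity_convolution => -[|[|l]]; rewrite /fps_add.
- by rewrite fpsXM0 /Useg /split_parity /nsegmentz nsegment0; case: a.
- by rewrite fpsXMS fpsXM0 /Useg /split_parity /nsegmentz nsegment1; case: a.
rewrite !fpsXMS.
have -> : (if a then 'x else 1%:S)%fps l.+2 = 0 :> int by case: a.
rewrite add0r /Useg /split_parity /= addbF negbK.
case: eqP => // al; rewrite [LHS]/nsegmentz nsegmentSS; last first.
  by rewrite oddD oddb al addbb.
rewrite (big_morph Posz PoszD (erefl _)); apply: eq_bigr => k _.
by rewrite convolution_nsegmentz nsegmentz_xor PoszM.
Qed.

Lemma Useg_Ue : (Useg false false =f Ue)%fps.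
Proof.
by move=> l; rewrite /Useg /split_parity /Ue /= u_nsegment; case: (odd l).
Qed.

Lemma Useg_Uo : (Useg false true =f Uo)%fps.
Proof.
by move=> l; rewrite /Useg /split_parity /Uo /= u_nsegment; case: (odd l).
Qed.

Lemma Useg_false_true :
  (Useg false true =f 'x * (Useg false false * Useg false false
                            + Useg false true * Useg true false))%fps.
Proof. by rewrite {1}(Useg_true false); ring. Qed.

Lemma Ue_Uo_eq :
  (Ue =f 1%:S + (1%:S + 1%:S) * ('x * (Ue * Uo)) + 'x * ('x * (Uo * Uo))
         - 'x * Uo)%fps.
Proof.
rewrite -Useg_Ue -Useg_Uo.
exact: (system_E_O (Useg_false false) Useg_false_true (Useg_false true)
                   (Useg_true true)).
Qed.

Lemma Uo_eq : (Uo =f 'x * (Ue * Ue + Uo * Uo))%fps.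
Proof.
rewrite -Useg_Ue -Useg_Uo.
exact: (system_O (Useg_false false) Useg_false_true (Useg_false true)
                 (Useg_true true)).
Qed.

(** Replacing the last term of [Ue_Uo_eq] by means of [Uo_eq] cancels the square of [Uo]. *)
Lemma Ue_eq :
  (Ue =f 1%:S + (1%:S + 1%:S) * 'x * Ue * Uo - 'x * 'x * (Ue * Ue))%fps.
Proof.
set r := ('x * Uo)%fps; have rE : (r =f 'x * ('x * (Ue * Ue + Uo * Uo)))%fps.
  by rewrite /r {1}Uo_eq.
by rewrite {1}Ue_Uo_eq -/r rE; ring.
Qed.

(** * Coefficient extraction and the recurrence *)

Lemma sum_parity (b : bool) (N : nat) (F : nat -> int) :
  \sum_(i < N) F (2 * i + b)%N = \sum_(k < 2 * N | odd k == b) F k.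
Proof.
elim: N => [|N IHN]; first by rewrite muln0 !big_ord0.
rewrite mulnS add2n big_ord_recr IHN /= !(big_mkcond (fun k => odd _ == b)).
rewrite !big_ord_recr /= -addrA; congr (_ + _); rewrite mul2n /= odd_double.
by case: b {IHN}; rewrite /= ?addr0 ?add0r ?addn0 ?addn1.
Qed.

Lemma sum_parity_convolution (b : bool) (N m : nat) (g h : nat -> int) :
  (m < N)%N ->
  \sum_(i < N) \sum_(j < N | (2 * i + b + j == m)%N) g (2 * i + b)%N * h j =
  \sum_(k < m.+1 | odd k == b) g k * h (m - k)%N.
Proof.
(* For each [i] at most one [j] fits, and none when [2 * i + b] exceeds [m]; hence the padding by
   0. *)
move=> mN; pose F k := if (k < m.+1)%N then g k * h (m - k)%N else 0.
rewrite (eq_bigr (fun i : 'I_N => F (2 * i + b)%N)) => [|i _].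
  rewrite sum_parity (big_ord_widen_cond (2 * N) (fun k => odd k == b)
                        (fun k => g k * h (m - k)%N)) ?big_mkcondr //; lia.
rewrite /F ltnS; case: leqP => le_m; last by rewrite big_pred0 // => j; lia.
have lt_N : (m - (2 * i + b) < N)%N by lia.
by rewrite (big_pred1 (Ordinal lt_N)) // => j; rewrite /= -val_eqE /=; lia.
Qed.

Lemma Ue_mul_Uo m : ~~ odd m ->
  (Ue * Uo)%fps m.+1 =
    \sum_(k < m.+2 | odd k == false) (u k)%:Z * (u (m.+1 - k))%:Z.
Proof.
move=> even_m; rewrite [RHS]big_mkcond; apply: eq_bigr => k _.
have := ltn_ord k; rewrite ltnS => km; rewrite /Ue /Uo oddB //= even_m.
by case: (odd k); rewrite /= ?mul0r.
Qed.

Lemma Uo_mul_Uo m : ~~ odd m ->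
  (Uo * Uo)%fps m = \sum_(k < m.+1 | odd k == true) (u k)%:Z * (u (m - k))%:Z.
Proof.
move=> even_m; rewrite [RHS]big_mkcond; apply: eq_bigr => k _.
have := ltn_ord k; rewrite ltnS => km; rewrite /Uo oddB //= (negbTE even_m).
by case: (odd k); rewrite /= ?mul0r.
Qed.

Theorem theorem3p6 :
  (forall n : nat, (1 <= n)%N ->
     (u (2 * n))%:Z =
       2 * (\sum_(i < 2 * n) \sum_(j < 2 * n | (2 * i + j == 2 * n - 1)%N)
              (u (2 * i))%:Z * (u j)%:Z)
       + (\sum_(i < 2 * n) \sum_(j < 2 * n | (2 * i + 1 + j == 2 * n - 2)%N)
            (u (2 * i + 1))%:Z * (u j)%:Z)
       - (u (2 * n - 1))%:Z)
  /\
  (Ue =1 1%:S + 2%:S * 'x * Ue * Uo - 'x ^+ 2 * Ue ^+ 2)%fps.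
Proof.
have two_fps : ((2 : int)%:S =f 1%:S + 1%:S)%fps.
  by move=> k; rewrite /fps_add /fpsC; case: eqP.
split=> [[//|n] _|]; last first.
  suff: (Ue =f 1%:S + 2%:S * 'x * Ue * Uo - 'x ^+ 2 * Ue ^+ 2)%fps by [].
  by rewrite two_fps !fps_expr2; apply: Ue_eq.
have even_2n : ~~ odd (2 * n) by rewrite mul2n odd_double.
have Ue_Uo_eq2 : (Ue =f 1%:S + (2 : int)%:S * ('x * (Ue * Uo))
                        + 'x * ('x * (Uo * Uo)) - 'x * Uo)%fps.
  by rewrite two_fps; apply: Ue_Uo_eq.
(* The case split on [n] replaced it by [n.+1], so the recurrence is read off in degree 2n + 2. *)
have := Ue_Uo_eq2 (2 * n).+2; rewrite /fps_sub /fps_add fpsCM.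
rewrite !fpsXMS add0r Ue_mul_Uo // Uo_mul_Uo //.
rewrite mulnS add2n subn1 subn2 /= {1}/Ue {1}/Uo /= negbK (negbTE even_2n) => ->.
pose uz k : int := (u k)%:Z; congr (2 * _ + _ - _).
  rewrite -(@sum_parity_convolution false (2 * n).+2 _ uz uz) //.
  by apply: eq_bigr => i _; apply: eq_big => [j|j _]; rewrite addn0.
by rewrite -(@sum_parity_convolution true (2 * n).+2 _ uz uz) // ltnS leqnSn.
Qed.
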